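(* Let $n\ge 3$ and let $A$ be an $n$-by-$n$ weighted shift matrix with nonzero complex weights $a_1,\ldots,a_n$. Then the following statements are equivalent: (a) $A$ is reducible. (b) $A$ has periodic weights, that is, for some fixed $k$, $1\le k\le\lfloor n/2\rfloor$, $n$ is divisible by $k$, and $|a_j|=|a_{k+j}|$ for all $1\le j\le n-k$. (c) There exists a fixed $k$, $1\le k\le\lfloor n/2\rfloor$, such that $n$ is divisible by $k$ and $A$ is unitarily equivalent to $e^{i\theta}\left(B\oplus(\omega B)\oplus\cdots\oplus(\omega^{(n/k)-1}B)\right)$, where $B$ is the $k$-by-$k$ weighted shift matrix with weights $|a_1|,\ldots,|a_k|$, $\omega=e^{2\pi i/n}$ and $\theta=\left(\sum_{j=1}^{n}\arg a_j\right)/n$.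
   Context: For $k\ge1$, a $k$-by-$k$ weighted shift matrix with weights $w_1,\ldots,w_k\in\mathbb{C}$ is the matrix whose $(j,j+1)$-entry is $w_j$ for $1\le j\le k-1$, whose $(k,1)$-entry is $w_k$, and whose other entries are all $0$ (for $k=1$ it is $[w_1]$). A square complex matrix is reducible if it is unitarily equivalent to the direct sum of two other (nonempty square) matrices. Matrices $A,B$ are unitarily equivalent if $B=U^*AU$ for some unitary $U$. For a nonzero complex number $z$, $\arg z\in[0,2\pi)$ denotes the angle from the positive $x$-axis to $z$. *)

(* Defs.v *)
From HB Require Import structures.
From mathcomp Require Import all_boot all_order all_algebra.
From mathcomp Require Import complex boolp classical_sets reals trigo.

Set Implicit Arguments.
Unset Strict Implicit.
Unset Printing Implicit Defensive.

Import Order.TTheory GRing.Theory Num.Theory.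
Local Open Scope ring_scope.
Local Open Scope complex_scope.
Local Open Scope sesquilinear_scope.

Section Defs.
Variable R : realType.
Local Notation C := (R[i]).

Definition expi (t : R) : C := cos t +i* sin t.

(* The angle of z in [0, 2 pi); only meaningful for z != 0, see cargP. *)
Definition carg (z : C) : R :=
  xget 0 [set t : R | 0 <= t < pi *+ 2 /\ z = `|z| * expi t]%classic.

(* Row i carries its weight in column i + 1 modulo k, so the last weight sits
   in the bottom left corner, and for k = 1 the matrix is [w_1].  Weights are
   indexed from 0. *)
Definition weighted_shift (k : nat) (w : k.-tuple C) : 'M[C]_k :=
  \matrix_(i, j) (if j == ordS i then tnth w i else 0).

(* The sizes are allowed to be provably rather than definitionally equal, so
   that A can be compared with block matrices of size m1 + m2 or \sum_i m. *)
Definition unitarily_equivalent (n m : nat) (A : 'M[C]_n) (B : 'M[C]_m) : Prop :=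
  exists (e : n = m) (U : 'M[C]_m),
    U \is unitarymx /\ B = U^t* *m castmx (e, e) A *m U.

Definition reducible (n : nat) (A : 'M[C]_n) : Prop :=
  exists (m1 m2 : nat) (A1 : 'M[C]_m1) (A2 : 'M[C]_m2),
    [/\ (0 < m1)%N, (0 < m2)%N
      & unitarily_equivalent A (block_mx A1 0 0 A2)].

Lemma cargP (z : C) : z != 0 ->
  0 <= carg z < pi *+ 2 /\ z = `|z| * expi (carg z).
Proof.
move=> z0; rewrite /carg; case: xgetP => [t -> //|] noarg; exfalso.
case: z z0 noarg => x y z0 noarg.
pose r := Num.sqrt (x ^+ 2 + y ^+ 2).
have nE : `|x +i* y| = r%:C by rewrite normc_def.
have s0 : 0 < x ^+ 2 + y ^+ 2.
  rewrite lt_def addr_ge0 ?sqr_ge0 // andbT paddr_eq0 ?sqr_ge0 //.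
  by rewrite !sqrf_eq0; move: z0; rewrite eq_complex.
have r0 : 0 < r by rewrite sqrtr_gt0.
have r2 : r ^+ 2 = x ^+ 2 + y ^+ 2 by rewrite sqr_sqrtr // ltW.
have xr : -1 <= x / r <= 1.
  rewrite -ler_norml normrM normfV (gtr0_norm r0) ler_pdivrMr // mul1r.
  rewrite -[r]gtr0_norm // -ler_sqr ?nnegrE // !real_normK ?num_real // r2.
  by rewrite lerDl sqr_ge0.
have sE : Num.sqrt (1 - (x / r) ^+ 2) = `|y| / r.
  have -> : 1 - (x / r) ^+ 2 = (`|y| / r) ^+ 2.
    rewrite !expr_div_n real_normK ?num_real // r2.
    apply: (mulIf (lt0r_neq0 s0)); rewrite mulrBl mul1r !divfK ?lt0r_neq0 //.
    by rewrite addrC addKr.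
  by rewrite sqrtr_sqr ger0_norm // divr_ge0 // ltW.
have xin : x / r \in `[(-1), 1] by rewrite in_itv.
have rn : r != 0 by rewrite lt0r_neq0.
have E t : cos t = x / r -> sin t = y / r -> x +i* y = `|x +i* y| * expi t.
  move=> ct st; rewrite nE /expi ct st /=.
  by apply/eqP; rewrite eq_complex /= !mul0r subr0 addr0 ![r * _]mulrC !divfK // !eqxx.
have pi0 := pi_gt0 R.
have [y0|y0] := leP 0 y.
  apply: (noarg (acos (x / r))); split.
    rewrite acos_ge0 //=; apply: le_lt_trans (acos_lepi xr) _.
    by rewrite mulr2n ltrDl.
  by apply: E; rewrite ?acosK // sin_acos // sE ger0_norm.
apply: (noarg (pi *+ 2 - acos (x / r))); split.
  have xr1 : -1 <= x / r < 1.
    move: xr => /andP[-> xr1]; rewrite lt_def xr1 andbT eq_sym.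
    apply: contraTneq y0 => x1; move: sE; rewrite x1 expr1n subrr sqrtr0.
    move/esym/eqP; rewrite mulf_eq0 invr_eq0 (negPf rn) orbF normr_eq0.
    by move/eqP->; rewrite ltxx.
  rewrite subr_ge0 ltrBlDr ltrDl acos_gt0 // andbT.
  by apply: le_trans (acos_lepi xr) _; rewrite mulr2n lerDl ltW.
apply: E.
  by rewrite addrC cosD cos2pi sin2pi mulr1 mulr0 subr0 cosN acosK.
rewrite addrC sinD cos2pi sin2pi mulr1 mulr0 addr0 sinN sin_acos // sE.
by rewrite ltr0_norm // mulNr opprK.
Qed.

End Defs.

(* Main.v *)
Require Import Defs.
From mathcomp Require Import all_boot all_order all_algebra.
From mathcomp Require Import complex reals trigo ring lra.

(** Index rows and columns cyclically, write A for the weighted shift matrix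
    with weights a_j, and e_j for the standard basis.

    (a) => (b).  A is reducible only if some non-scalar matrix X commutes with
    both A and its adjoint: conjugate the projection onto the first summand
    back by the unitary ([reducible_commutant]).  Comparing entries in
    X A = A X gives X_{i,j} a_j = a_i X_{i+1,j+1}.  If X were diagonal, its
    diagonal would be constant and X scalar; so X_{i,j} != 0 for some i != j,
    and then X does not vanish anywhere on the cyclic diagonal through (i, j)
    because the weights are nonzero.  Since X also commutes with A A^*, which
    is diag(|a_j|^2), it follows that |a_{i+t}| = |a_{j+t}| for all t
    ([reducible_weighted_shift_norm]).  So the moduli are (j - i)-periodic on
    Z/n, hence periodic with the proper divisor gcd(n, j - i) of n as period
    ([periodic_of_agreeing_shifts]).

    (b) => (c).  The diagonal unitary with entries
    d_j = e^{i (j theta - arg a_0 - ... - arg a_{j-1})} turns A into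
    e^{i theta} |A|: the defining choice of theta is exactly what makes
    d_n = d_0 ([phase_wrap]).  With m = n / k and omega = e^{2 pi i / n}, the
    vectors obtained by restricting the Fourier vector (omega^{l j})_j to one
    residue class r modulo k,
      v_{l,r} = m^{-1/2} sum_{j = r mod k} omega^{l j} d_j e_j,
    are an orthonormal basis as l < m and r < k vary
    ([period_blocks_unitary]), and
      A v_{l,r+1} = e^{i theta} omega^l |a_r| v_{l,r},
    cyclically in r since omega^n = 1.  So A acts on the span of
    v_{l,0}, ..., v_{l,k-1} as e^{i theta} omega^l B
    ([period_block_intertwine]).

    (c) => (a).  There are n / k >= 2 diagonal blocks, so the first one can be
    separated from the others. *)

Set Implicit Arguments.
Unset Strict Implicit.
Unset Printing Implicit Defensive.

Import Order.TTheory GRing.Theory Num.Theory.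
Local Open Scope ring_scope.
Local Open Scope complex_scope.
Local Open Scope sesquilinear_scope.

(** * The complex exponential and roots of unity *)

Section Phase.
Variable R : realType.
Implicit Types s t : R.

Lemma expi0 : expi (0 : R) = 1.
Proof. by rewrite /expi cos0 sin0. Qed.

Lemma expiD s t : expi (s + t) = expi s * expi t.
Proof.
rewrite /expi cosD sinD; apply/eqP; rewrite eq_complex /= eqxx /=.
by rewrite addrC.
Qed.

Lemma expiX t m : expi t ^+ m = expi (t *+ m).
Proof.
elim: m => [|m IH]; first by rewrite expr0 mulr0n expi0.
by rewrite exprS IH mulrS expiD.
Qed.

Lemma norm_expi t : `|expi t| = 1.
Proof. by rewrite /expi normc_def cos2Dsin2 sqrtr1. Qed.

Lemma expi_conj t : expi t * Num.conj (expi t) = 1.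
Proof. by rewrite -normCK norm_expi expr1n. Qed.

Lemma expi_neq1 t : 0 < t < pi *+ 2 -> expi t != 1.
Proof.
case/andP=> t0 t2; apply/eqP => -[c1 _].
have s0 : 0 < sin (t / 2).
  by rewrite sin_gt0_pi // divr_gt0 //= ltr_pdivrMr // mulr_natr.
have tE : t = (t / 2) *+ 2 by rewrite -[RHS]mulr_natr divfK // pnatr_eq0.
move: c1; rewrite {1}tE cos_mulr2n; have := cos2Dsin2 (t / 2).
have : 0 < sin (t / 2) ^+ 2 by rewrite exprn_gt0.
lra.
Qed.

Lemma expi_primitive_root n : (0 < n)%N ->
  n.-primitive_root (expi (pi *+ 2 / n%:R) : R[i]).
Proof.
move=> n0; have nn : (n%:R : R) != 0 by rewrite pnatr_eq0 -lt0n.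
have p0 : 0 < (pi : R) *+ 2 by rewrite pmulrn_lgt0 ?pi_gt0.
rewrite /primitive_root_of_unity n0; apply/forallP => i.
rewrite unity_rootE expiX -[_ *+ i.+1]mulr_natr.
have := ltn_ord i; rewrite leq_eqVlt => /predU1P[iE|iE].
  by rewrite iE divfK // eqxx /expi cos2pi sin2pi; apply/eqP/eqP.
rewrite (ltn_eqF iE) eqbF_neg; apply: expi_neq1.
rewrite mulr_gt0 ?divr_gt0 ?ltr0n //= mulrAC ltr_pdivrMr ?ltr0n //.
by rewrite ltr_pM2l // ltr_nat.
Qed.

End Phase.

(** A geometric sum with ratio q = w^(i-j), written as a quotient because
    exponents are natural numbers.  The congruence modulo k makes q an
    (n / k)-th root of unity, so the sum vanishes unless q = 1. *)
Lemma prim_root_sum (F : fieldType) (n k : nat) (w : F) (i j : nat) :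
  n.-primitive_root w -> (k %| n)%N -> i = j %[mod k] ->
  \sum_(l < n %/ k) (w ^+ i / w ^+ j) ^+ l
    = if i == j %[mod n] then (n %/ k)%:R else 0.
Proof.
move=> wP kn ij; set q := _ / _.
have wj m : w ^+ m != 0.
  rewrite expf_neq0 //; apply: contra_eq_neq (prim_expr_order wP) => ->.
  by rewrite expr0n gtn_eqF ?(prim_order_gt0 wP) // eq_sym oner_neq0.
have q1 : (q == 1) = (i == j %[mod n]).
  by rewrite -(eq_prim_root_expr wP) -(inj_eq (mulIf (wj j))) mul1r divfK.
rewrite -q1; case: ifPn => [/eqP->|qn].
  under eq_bigr do rewrite expr1n.
  by rewrite sumr_const card_ord.
apply: (mulfI (_ : q - 1 != 0)); first by rewrite subr_eq0.
rewrite mulr0 -subrX1; apply/eqP; rewrite subr_eq0 expr_div_n -!exprM.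
suff -> : w ^+ (i * (n %/ k)) = w ^+ (j * (n %/ k)).
  by rewrite divff.
apply/eqP; rewrite (eq_prim_root_expr wP) -{2 4}(divnK kn).
rewrite ![(_ * (n %/ k))%N]mulnC.
by rewrite -!muln_modr ij.
Qed.

(** * Unitary equivalence and reducibility *)

Section UnitaryEquivalence.
Variable R : realType.
Local Notation C := R[i].

(** The rectangular type of U lets its columns be indexed by the blocks of B
    without casting A. *)
Lemma unitarily_equivalent_intertwine n m (A : 'M[C]_n) (B : 'M[C]_m)
    (U : 'M_(n, m)) :
  n = m -> U \is unitarymx -> A *m U = U *m B -> unitarily_equivalent A B.
Proof.
move=> e; case: _ / e B U => B U Uu AU.
exists erefl, U; split=> //; rewrite castmx_id -mulmxA AU.
have Uu' : U^t* \is unitarymx by rewrite trmxC_unitary.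
by move/unitarymxP: Uu'; rewrite trmxCK mulmxA => ->; rewrite mul1mx.
Qed.

Lemma unitarily_equivalent_cast n m p (e : m = p) (A : 'M[C]_n) c
    (B : 'M[C]_m) :
  unitarily_equivalent A (c *: castmx (e, e) B) ->
  unitarily_equivalent A (c *: B).
Proof. by case: _ / e; rewrite castmx_id. Qed.

(** X is the orthogonal projection onto the first summand, carried back by
    the unitary; both summands being nonempty, it is neither 0 nor 1, and a
    projection with both eigenvalues 0 and 1 is not scalar. *)
Lemma reducible_commutant n (A : 'M[C]_n) : reducible A ->
  exists X : 'M[C]_n,
    [/\ X *m A = A *m X, X *m A^t* = A^t* *m X & ~ exists c, X = c%:M].
Proof.
case=> m1 [m2] [A1] [A2] [m1_gt0 m2_gt0 [e]]; subst n.
rewrite castmx_id => -[U [Uu DE]]; set D := block_mx _ _ _ _ in DE.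
pose P : 'M[C]_(m1 + m2) := block_mx 1%:M 0 0 0.
have UU : U *m U^t* = 1%:M by apply/unitarymxP.
have UU' : U^t* *m U = 1%:M.
  by move: Uu; rewrite -trmxC_unitary => /unitarymxP; rewrite trmxCK.
have AE : A = U *m D *m U^t*.
  by rewrite DE !mulmxA UU mul1mx -mulmxA UU mulmx1.
have AE' : A^t* = U *m D^t* *m U^t*.
  by rewrite AE !trmx_mul !map_mxM trmxCK mulmxA.
have PD : P *m D = D *m P.
  by rewrite !mulmx_block !(mul1mx, mulmx1, mul0mx, mulmx0, addr0).
have PD' : P *m D^t* = D^t* *m P.
  rewrite tr_block_mx map_block_mx !trmx0 !map_mx0.
  by rewrite !mulmx_block !(mul1mx, mulmx1, mul0mx, mulmx0, addr0).
have conj_comm E : P *m E = E *m P ->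
    U *m P *m U^t* *m (U *m E *m U^t*) = U *m E *m U^t* *m (U *m P *m U^t*).
  move=> PE; rewrite !mulmxA -(mulmxA (U *m P)) UU' mulmx1.
  rewrite -(mulmxA (U *m E)) UU' mulmx1.
  by rewrite -!(mulmxA U) -!(mulmxA P) !(mulmxA P) PE mulmxA.
exists (U *m P *m U^t*); split.
- by rewrite AE; apply: conj_comm PD.
- by rewrite AE'; apply: conj_comm PD'.
case=> c XE; have PE : P = c%:M.
  have: U^t* *m (U *m P *m U^t*) *m U = c%:M.
    by rewrite XE mul_mx_scalar -scalemxAl UU' scalemx1.
  by rewrite !mulmxA UU' mul1mx -mulmxA UU' mulmx1.
move/matrixP: PE => Pc.
(* P has the diagonal entry 1 in the first block and 0 in the second. *)
have := Pc (lshift m2 (Ordinal m1_gt0)) (lshift m2 (Ordinal m1_gt0)).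
have := Pc (rshift m1 (Ordinal m2_gt0)) (rshift m1 (Ordinal m2_gt0)).
rewrite block_mxEul block_mxEdr !mxE !eqxx => <- /eqP; exact/negP/oner_neq0.
Qed.

End UnitaryEquivalence.

(** * Periodic sequences *)

Definition periodic (T : Type) (g : nat -> T) d := forall t, g (t + d)%N = g t.

Lemma periodicM (T : Type) (g : nat -> T) d q :
  periodic g d -> periodic g (q * d).
Proof.
by move=> gd; elim: q => [|q IH] t; rewrite ?addn0 // mulSn addnA IH gd.
Qed.

(** By Bezout, gcd(n, d) + b d is a multiple of n for some natural b, so that
    a shift by gcd(n, d) can be completed by harmless shifts by d. *)
Lemma periodic_gcd (T : Type) (g : nat -> T) d n : (0 < n)%N ->
  periodic g d -> periodic g n -> periodic g (gcdn n d).
Proof.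
move=> n0 gd gn t; have [b _ /dvdnP[q E]] := Bezoutl d n0.
by rewrite -(periodicM b gd) -addnA E periodicM.
Qed.

(** The period is gcd(n, d) where d = j - i modulo n; it is less than n since
    n does not divide d, and a proper divisor of n is at most n / 2. *)
Lemma periodic_of_agreeing_shifts (T : Type) (g : nat -> T) n (i j : 'I_n) :
    i != j -> periodic g n -> (forall t, g (i + t)%N = g (j + t)%N) ->
  exists k : nat, [/\ (1 <= k <= n %/ 2)%N, (k %| n)%N & periodic g k].
Proof.
move=> ij gn gij; have n0 : (0 < n)%N by case: n i {ij j gn gij} => [[]|].
have gd : periodic g (n - i + j).
  by move=> t; rewrite addnA addnC -gij addnCA subnKC ?gn // ltnW.
exists (gcdn n (n - i + j)); rewrite dvdn_gcdl gcdn_gt0 n0 /=.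
split=> //; last exact: periodic_gcd.
case/dvdnP: (dvdn_gcdl n (n - i + j)) => q nE.
set k := gcdn _ _ in nE *.
(* For q = 1, n = k would divide j - i. *)
have q1 : (1 < q)%N.
  case: q nE => [|[|q]] // nE; first by rewrite nE mul0n in n0.
  suff : i = j %[mod n].
    by rewrite !modn_small // => /val_inj ijE; rewrite ijE eqxx in ij.
  have /dvdnP[b bE] : (n %| n - i + j)%N by rewrite {1}nE mul1n dvdn_gcdr.
  rewrite -[LHS](modnMDl b) -bE addnAC subnK ?(ltnW (ltn_ord i)) //.
  by rewrite modnDl.
by rewrite leq_divRL // [X in (_ <= X)%N]nE mulnC leq_mul2r q1 orbT.
Qed.

(** * Reducible weighted shifts have periodic moduli *)

Section WeightedShift.
Variable R : realType.
Local Notation C := R[i].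

Lemma mul_weighted_shift n m (w : n.-tuple C) (U : 'M_(n, m)) i j :
  (weighted_shift w *m U) i j = tnth w i * U (ordS i) j.
Proof.
rewrite mxE (bigD1 (ordS i)) //= big1 => [|l li];
  first by rewrite mxE eqxx addr0.
by rewrite mxE (negPf li) mul0r.
Qed.

Lemma mulmx_weighted_shift n m (w : n.-tuple C) (U : 'M_(m, n)) i j :
  (U *m weighted_shift w) i (ordS j) = U i j * tnth w j.
Proof.
rewrite mxE (bigD1 j) //= big1 => [|l li];
  first by rewrite mxE eqxx addr0.
by rewrite mxE (inj_eq (@ordS_inj _)) eq_sym (negPf li) mulr0.
Qed.

Lemma weighted_shift_mul_adj n (w : n.-tuple C) :
  weighted_shift w *m (weighted_shift w)^t*
    = diag_mx (\row_i (`|tnth w i| ^+ 2)).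
Proof.
apply/matrixP => i j.
rewrite mul_weighted_shift !mxE (inj_eq (@ordS_inj _)) normCK.
by have [->|ij] := eqVneq i j; rewrite ?mulr1n //= rmorph0 mulr0.
Qed.

Lemma val_iter_ordS n (i : 'I_n) t :
  iter t (@ordS n) i = ((i + t) %% n)%N :> nat.
Proof.
elim: t => [|t /= ->]; first by rewrite addn0 modn_small.
by rewrite -addn1 modnDml addn1 addnS.
Qed.

(** For an X commuting with the shift, consecutive entries along a cyclic
    diagonal differ by the nonzero factor a_j / a_i. *)
Lemma comm_weighted_shift_iter n (w : n.-tuple C) (X : 'M_n) i j t :
    (forall l, tnth w l != 0) ->
    X *m weighted_shift w = weighted_shift w *m X ->
  (X (iter t (@ordS n) i) (iter t (@ordS n) j) == 0) = (X i j == 0).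
Proof.
move=> w0 XA; elim: t => //= t <-; set i' := iter t _ i; set j' := iter t _ j.
have := congr1 (fun M : 'M_n => M i' (ordS j')) XA.
rewrite mulmx_weighted_shift mul_weighted_shift => /eqP XE.
rewrite -(mulrI_eq0 _ (mulfI (w0 i'))) -(eqP XE).
by rewrite (mulIr_eq0 _ (mulIf (w0 j'))).
Qed.

(** A non-scalar X in the commutant of A and A^* has a nonzero entry off the
    diagonal, hence a whole nonvanishing cyclic diagonal; commutation with the
    diagonal matrix A A^* then equates the moduli of the weights at the two
    ends of each of its entries. *)
Lemma reducible_weighted_shift_norm n (w : n.-tuple C) :
    (forall l, tnth w l != 0) -> reducible (weighted_shift w) ->
  exists i j : 'I_n, i != j /\
    forall t, `|w`_((i + t) %% n)| = `|w`_((j + t) %% n)|.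
Proof.
move=> w0 /reducible_commutant[X [XA XA' Xns]].
case: (pickP (fun p : 'I_n * 'I_n => (p.1 != p.2) && (X p.1 p.2 != 0))).
  move=> [i j] /= /andP[ij Xij]; exists i, j; split=> // t.
  rewrite -!val_iter_ordS -!tnth_nth.
  set i' := iter t _ i; set j' := iter t _ j.
  have Xn0 : X i' j' != 0 by rewrite (comm_weighted_shift_iter _ _ _ w0 XA).
  have XD : X *m (weighted_shift w *m (weighted_shift w)^t*) =
      weighted_shift w *m (weighted_shift w)^t* *m X.
    by rewrite mulmxA XA -!mulmxA XA'.
  move: XD; rewrite weighted_shift_mul_adj => /matrixP/(_ i' j').
  rewrite mul_mx_diag mul_diag_mx !mxE mulrC => /(mulIf Xn0)/eqP.
  by rewrite eqrXn2 // => /eqP.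
(* A diagonal X would have a constant diagonal, so be scalar. *)
move=> Xdiag; case: Xns; case: n => [|n] in w w0 X XA XA' Xdiag *.
  by exists 0; apply/matrixP => -[].
exists (X ord0 ord0); apply/matrixP => i j; rewrite mxE.
have [<-|ij] := eqVneq i j; last first.
  by have /= := Xdiag (i, j); rewrite ij /= => /negbFE/eqP->.
rewrite mulr1n.
have -> : i = iter i (@ordS n.+1) ord0.
  by apply: ord_inj; rewrite val_iter_ordS add0n modn_small.
elim: (val i) => //= t IH; set l := iter t _ _ in IH *.
have := congr1 (fun M : 'M_n.+1 => M l (ordS l)) XA.
rewrite mulmx_weighted_shift mul_weighted_shift mulrC => /(mulfI (w0 l)) <-.
exact: IH.
Qed.

End WeightedShift.

(** * Decomposition for periodic moduli *)

Section PeriodicWeights.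
Variables (R : realType) (n : nat) (a : n.-tuple R[i]).
Hypothesis n0 : (0 < n)%N.
Hypothesis ha : forall j : 'I_n, tnth a j != 0.
Local Notation C := R[i].

Let theta := (\sum_(j < n) carg (tnth a j)) / n%:R.

(** Diagonal entries of the unitary that straightens the arguments of the
    weights: each step from j to j + 1 adds theta and absorbs arg a_j. *)
Definition phase (j : nat) : C :=
  expi (theta *+ j - \sum_(0 <= i < j) carg a`_i).

Lemma phase_conj j : phase j * Num.conj (phase j) = 1.
Proof. exact: expi_conj. Qed.

(** The phases close up around the cycle because n theta is the total
    argument of the weights. *)
Lemma phase_wrap : phase n = phase 0.
Proof.
rewrite /phase [in RHS]big_geq // subr0 mulr0n.
rewrite big_mkord -[_ *+ n]mulr_natr divfK.
  by under eq_bigr do rewrite (tnth_nth 0); rewrite subrr.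
by rewrite pnatr_eq0 -lt0n.
Qed.

(** Conjugation by the phases turns each weight a_j into
    e^{i theta} |a_j|, the wrapping weight included. *)
Lemma phase_ordS (j : 'I_n) :
  tnth a j * phase (ordS j) = `|a`_j| * (expi theta * phase j).
Proof.
have -> : phase (ordS j) = phase j.+1.
  have := ltn_ord j; rewrite /= leq_eqVlt => /predU1P[->|jn].
    by rewrite modnn phase_wrap.
  by rewrite modn_small.
have [_ {1}->] := cargP (ha j); rewrite (tnth_nth 0) -mulrA; congr (_ * _).
rewrite -!expiD mulrS big_nat_recr //=; congr expi.
by move: (theta *+ j) => x; lra.
Qed.

Variable k : nat.
Hypothesis kn : (k %| n)%N.
Hypothesis ak : forall j : nat, (j < n - k)%N -> `|a`_j| = `|a`_(k + j)|.

Lemma norm_weight_mod j : (j < n)%N -> `|a`_j| = `|a`_(j %% k)|.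
Proof.
move=> jn; rewrite {1}(divn_eq j k) addnC.
have: (j %% k + j %/ k * k < n)%N by rewrite addnC -divn_eq.
elim: (j %/ k)%N => [|q IH]; rewrite ?addn0 // mulSn addnCA => qn.
by rewrite -ak ?ltn_subRL // IH // (leq_ltn_trans _ qn) // leq_addl.
Qed.

Let w : C := expi (pi *+ 2 / n%:R).
Let m := (n %/ k)%N.
Let B := weighted_shift [tuple `|a`_j| | j < k].

(** Column r is the normalised l-th Fourier vector restricted to the indices
    congruent to r modulo k, twisted by the phases. *)
Definition period_block (l : nat) : 'M[C]_(n, k) :=
  \matrix_(j, r) (if j == r %[mod k] then
                   sqrtC (m%:R^-1) * phase j * w ^+ (l * j) else 0).

Let w_prim : n.-primitive_root w := expi_primitive_root R n0.

(** Moving one step along the cycle multiplies the Fourier coefficient by w^l,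
    also when the index wraps around because w^n = 1, and meets a weight whose
    modulus depends only on the index modulo k. *)
Lemma period_block_intertwine l :
  weighted_shift a *m period_block l
    = period_block l *m (expi theta *: (w ^+ l *: B)).
Proof.
apply/matrixP => j r; rewrite mul_weighted_shift -!scalemxAr.
have k0 : (0 < k)%N by case: (k) r => [[]|].
rewrite -[r]ord_predK; move: (ord_pred r) => s {r}.
rewrite [RHS]mxE [X in _ = _ * X]mxE mulmx_weighted_shift.
rewrite tnth_mktuple !mxE /=.
rewrite modn_dvdm // modn_mod -[j.+1]addn1 -[s.+1]addn1 eqn_modDr.
case: ifPn => [/eqP js|]; last by rewrite !(mul0r, mulr0).
have -> : `|a`_s| = `|a`_j| by rewrite [RHS]norm_weight_mod // js modn_small.
have -> : w ^+ (l * ((j + 1) %% n)) = w ^+ l * w ^+ (l * j).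
  rewrite -exprD; apply/eqP; rewrite (eq_prim_root_expr w_prim).
  by rewrite modnMmr mulnDr muln1 addnC.
have := phase_ordS j; rewrite /= -addn1 => E.
set c := sqrtC _; set v := w ^+ (l * j).
rewrite (_ : _ * _ = tnth a j * phase ((j + 1) %% n) * (c * (w ^+ l * v)));
  last by ring.
by rewrite E; ring.
Qed.

(** Rows i and j meet in a common column only if i = j modulo k, and then in
    exactly one. *)
Lemma period_block_mul_adj l (i j : 'I_n) :
  (period_block l *m (period_block l)^t*) i j =
    if i == j %[mod k] then
      m%:R^-1 * (phase i * Num.conj (phase j)) * (w ^+ i / w ^+ j) ^+ l
    else 0.
Proof.
have k0 := dvdn_gt0 n0 kn.
rewrite mxE (bigD1 (Ordinal (ltn_pmod i k0))) //= big1 => [|r ri]; last first.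
  rewrite !mxE [i == r %[mod k]]eq_sym [(r %% k)%N]modn_small //.
  by rewrite -val_eqE /= in ri; rewrite (negPf ri) mul0r.
rewrite addr0 !mxE /= modn_mod eqxx [j == i %[mod k]]eq_sym.
case: ifP => _; last by rewrite conjC0 mulr0.
have wV : Num.conj (w ^+ (l * j)) = (w ^+ (l * j))^-1.
  by rewrite invC_norm normrX norm_expi !expr1n invr1 mul1r.
have cc : sqrtC (m%:R^-1) * Num.conj (sqrtC (m%:R^-1)) = m%:R^-1 :> C.
  by rewrite -normCK -normrX sqrtCK ger0_norm // invr_ge0 ler0n.
rewrite !rmorphM /= wV -[in RHS]cc expr_div_n -!exprM ![(_ * l)%N]mulnC.
by ring.
Qed.

(** The inner product of two rows congruent modulo k is, up to a factor of
    modulus 1 / m, the geometric sum over l of [prim_root_sum]. *)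
Lemma period_blocks_unitary : \mxrow_(l < m) period_block l \is unitarymx.
Proof.
apply/unitarymxP; rewrite tr_mxrow.
have -> : (\mxcol_(l < m) (period_block l)^T) ^ Num.conj
    = \mxcol_(l < m) (period_block l)^t*.
  by apply/matrixP => i j; rewrite !mxE.
rewrite mul_mxrow_mxcol; apply/matrixP => i j; rewrite summxE mxE.
under eq_bigr do rewrite period_block_mul_adj.
case: (boolP (i == j %[mod k])) => ij; last first.
  have /negPf-> : i != j by apply: contraNneq ij => ->.
  by rewrite big1.
rewrite -mulr_sumr (prim_root_sum w_prim kn (eqP ij)).
rewrite !modn_small // val_eqE; have [->|_] := eqVneq i j;
  last by rewrite mulr0.
rewrite phase_conj mulr1 mulVf // pnatr_eq0 -lt0n.
by rewrite /m divn_gt0 ?(dvdn_gt0 n0 kn) // dvdn_leq.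
Qed.

Lemma periodic_weighted_shift_equiv :
  unitarily_equivalent (weighted_shift a)
    (expi theta *: \mxdiag_(l < m) (w ^+ l *: B)).
Proof.
apply: (unitarily_equivalent_intertwine _ period_blocks_unitary).
  by rewrite sum_nat_const card_ord divnK.
rewrite -scalemxAr mul_mxrow mul_mxrow_mxdiag; apply/matrixP => i t.
rewrite [LHS]mxE [RHS]mxE [X in _ = _ * X]mxE.
by rewrite period_block_intertwine -scalemxAr [LHS]mxE.
Qed.

End PeriodicWeights.

(** * The equivalence *)

Lemma unitarily_equivalent_mxdiag_reducible (R : realType) n (A : 'M[R[i]]_n) c
    m k (B : 'I_m -> 'M_k) :
    (1 < m)%N -> (0 < k)%N ->
  unitarily_equivalent A (c *: \mxdiag_(l < m) B l) -> reducible A.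
Proof.
case: m B => [|[|m]] // B _ k0; rewrite mxdiag_recl => AB.
exists k, (\sum_(l < m.+1) k)%N, (c *: B 0), (c *: \mxdiag_l B (lift ord0 l)).
split=> //; first by rewrite sum_nat_const card_ord mulSn addn_gt0 k0.
by have := unitarily_equivalent_cast AB; rewrite scale_block_mx !scaler0.
Qed.

Theorem theorem3p1 (R : realType) (n : nat) (a : n.-tuple R[i])
    (hn : (3 <= n)%N) (ha : forall j : 'I_n, tnth a j != 0) :
  [<-> reducible (weighted_shift a) ;
       exists k : nat, [/\ (1 <= k <= n %/ 2)%N, (k %| n)%N &
         forall j : nat, (j < n - k)%N -> `|a`_j| = `|a`_(k + j)|] ;
       exists k : nat, [/\ (1 <= k <= n %/ 2)%N, (k %| n)%N &
         let B := weighted_shift [tuple `|a`_j| | j < k] in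
         let omega := expi (pi *+ 2 / n%:R) in
         let theta := (\sum_(j < n) carg (tnth a j)) / n%:R in
         unitarily_equivalent (weighted_shift a)
           (expi theta *: \mxdiag_(i < n %/ k) (omega ^+ i *: B))]].
Proof.
have n0 : (0 < n)%N by apply: leq_trans hn.
tfae.
- move/(reducible_weighted_shift_norm ha) => [i [j [ij aij]]].
  have gn : periodic (fun t => `|a`_(t %% n)|) n by move=> t; rewrite modnDr.
  have [k [kn2 kn gk]] := periodic_of_agreeing_shifts ij gn aij.
  exists k; split=> // t; rewrite ltn_subRL => tn.
  have := gk t; rewrite addnC !modn_small // (leq_ltn_trans _ tn) //.
  exact: leq_addl.
- case=> k [kn2 kn ak]; exists k; split=> //.
  exact: periodic_weighted_shift_equiv.
- case=> k [/andP[k0 kn2] kn /= eqA].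
  apply: unitarily_equivalent_mxdiag_reducible eqA => //.
  by rewrite leq_divRL // mulnC -leq_divRL.
Qed.
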